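(* Let $\sigma:\mathbb R\to\mathbb R$ be a measurable activation function, let $A,C\in\mathbb R^{m\times n}$, $b,d\in\mathbb R^m$, and let $g_\sigma(x;A,b,C,d)=\sigma(Ax+b)+Cx+d$, with $\sigma$ applied elementwise. Let $X\sim\mathcal N(\mu,\Sigma)$ in $\mathbb R^n$, and assume $\mathbb E\,\sigma\big((AX+b)_i\big)^2<\infty$ for every $i$. For $1\le i,j\le m$ put $$\eta_i=(A\mu+b)_i,\quad \nu_{ij}=(A\Sigma A^{\top})_{i,j},\quad \tau_{ij}=(C\Sigma C^{\top})_{i,j},\quad \kappa_{ij}=(A\Sigma C^{\top})_{i,j}.$$ Then for all $i,j$, $$\big(\mathbb E\,g_\sigma(X;A,b,C,d)\big)_i=M_\sigma(\eta_i;\nu_{ii})+(C\mu)_i+d_i$$ and $$\big(\operatorname{Cov} g_\sigma(X;A,b,C,d)\big)_{i,j}=K_\sigma(\eta_i,\eta_j;\nu_{ii},\nu_{jj},\nu_{ij})+L_\sigma(\eta_i;\nu_{ii},\tau_{jj},\kappa_{ij})+L_\sigma(\eta_j;\nu_{jj},\tau_{ii},\kappa_{ji})+\tau_{ij}.$$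
   Context: For $\sigma:\mathbb R\to\mathbb R$, whenever the moments exist, define $M_\sigma(\mu;\nu)=\mathbb E\,\sigma(Z)$ for $Z\sim\mathcal N(\mu,\nu)$; $K_\sigma(\mu_1,\mu_2;\nu_{11},\nu_{22},\nu_{12})=\operatorname{Cov}(\sigma(Z_1),\sigma(Z_2))$ where $(Z_1,Z_2)$ is jointly normal with means $\mu_1,\mu_2$ and covariance matrix $\begin{pmatrix}\nu_{11}&\nu_{12}\\ \nu_{12}&\nu_{22}\end{pmatrix}$; $L_\sigma(\mu_1;\nu_{11},\nu_{22},\nu_{12})=\operatorname{Cov}(\sigma(Z_1),Z_2)$ where $(Z_1,Z_2)$ is jointly normal with that covariance matrix, $\mathbb E Z_1=\mu_1$ and $\mathbb E Z_2$ arbitrary (the value does not depend on it). Covariance matrices are symmetric positive semidefinite and may be singular. *)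

(* Defs.v *)
From HB Require Import structures.
From mathcomp Require Import all_boot all_order all_algebra.
From mathcomp Require Import ring.
From mathcomp Require Import all_classical all_reals all_analysis.
From mathcomp Require Import measurable_realfun.

Set Implicit Arguments.
Unset Strict Implicit.
Unset Printing Implicit Defensive.

Import Order.TTheory GRing.Theory Num.Theory.
Import numFieldNormedType.Exports.

Local Open Scope classical_set_scope.
Local Open Scope ring_scope.

Definition measure_matrix_display : measure_display -> measure_display.
Proof. exact. Qed.

(* Product sigma-algebra on matrices: the one generated by the entries. *)
Section measurable_matrix.
Context {d} {T : measurableType d}.
Variables m n : nat.

Definition matrix_sigma : set (set 'M[T]_(m, n)) :=
  <<s \bigcup_ij
    preimage_set_system setT (fun M : 'M[T]_(m, n) => M ij.1 ij.2) measurable >>.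

Let matrix_set0 : matrix_sigma set0.
Proof. exact: sigma_algebra0. Qed.

Let matrix_setC A : matrix_sigma A -> matrix_sigma (~` A).
Proof. exact: sigma_algebraC. Qed.

Let matrix_bigcup (F : _^nat) :
  (forall i, matrix_sigma (F i)) -> matrix_sigma (\bigcup_i F i).
Proof. exact: sigma_algebra_bigcup. Qed.

HB.instance Definition _ := @isMeasurable.Build (measure_matrix_display d)
  'M[T]_(m, n) matrix_sigma matrix_set0 matrix_setC matrix_bigcup.

End measurable_matrix.

Lemma measurable_entry d (T : measurableType d) m n (i : 'I_m) (j : 'I_n) :
  measurable_fun [set: 'M[T]_(m, n)] (fun M : 'M[T]_(m, n) => M i j).
Proof.
move=> _ Y mY; rewrite setTI; apply: sub_sigma_algebra.
by exists (i, j) => //; exists Y => //; rewrite setTI.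
Qed.

Lemma measurable_fun_matrixP d d' (T : measurableType d) (T' : measurableType d')
    m n (f : T' -> 'M[T]_(m, n)) :
  measurable_fun setT f <->
  forall i j, measurable_fun setT (fun x => f x i j).
Proof.
split=> [mf i j|mf].
  exact: (measurableT_comp (measurable_entry i j) mf).
apply: (measurability (\bigcup_ij preimage_set_system setT
   (fun M : 'M[T]_(m, n) => M ij.1 ij.2) measurable)) => //.
move=> _ [_ [[i j] _ [A mA <-]] <-]; rewrite !setTI.
by have := mf i j measurableT _ mA; rewrite setTI.
Qed.

(* Symmetric positive semidefinite matrices, possibly singular. *)
Definition psdmx {R : numDomainType} n (S : 'M[R]_n) : Prop :=
  S^T = S /\ forall v : 'cV[R]_n, 0 <= (v^T *m S *m v) 0 0.

Lemma psdmx_factor (R : rcfType) n (S : 'M[R]_n) :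
  psdmx S -> exists B : 'M[R]_n, B *m B^T = S.
Proof.
elim: n S => [|n IHn] S [symS psdS].
  by exists 0; apply/matrixP => -[].
pose S1 : 'M[R]_(1 + n) := S.
pose a := ulsubmx S1 0 0; pose r := ursubmx S1; pose T := drsubmx S1.
have symS1 : S1^T = S1 by [].
have aE : ulsubmx S1 = a%:M by exact: mx11_scalar.
have rE : dlsubmx S1 = r^T by rewrite /r trmx_ursub symS1.
have symT : T^T = T by rewrite /T trmx_drsub symS1.
have SE : S1 = block_mx a%:M r r^T T by rewrite -aE -rE submxK.
have qE t (v : 'cV_n) : 0 <= a * t ^+ 2 + (r *m v) 0 0 * t *+ 2
    + (v^T *m T *m v) 0 0.
  have := psdS (col_mx t%:M v).
  rewrite -[_ *m _ *m _]/((col_mx (t%:M : 'M[R]_1) v)^T *m S1 *m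
    col_mx (t%:M : 'M[R]_1) v).
  rewrite SE tr_col_mx mul_row_block mul_row_col.
  rewrite !mulmxDl tr_scalar_mx !mul_scalar_mx !mul_mx_scalar -!scalemxAl.
  have -> : v^T *m r^T = (r *m v)^T by rewrite trmx_mul.
  rewrite [r *m v]mx11_scalar tr_scalar_mx.
  rewrite [v^T *m T *m v]mx11_scalar !scale_scalar_mx -!raddfD/= !mxE eqxx !mulr1n.
  move=> h; rewrite (le_trans h)// le_eqVlt; apply/orP; left; apply/eqP; ring.
have a_ge0 : 0 <= a.
  by have := qE 1 0; rewrite !mulmx0 !mxE expr1n mulr1 mul0r mul0rn !addr0.
have r0 : a = 0 -> r = 0.
  move=> a0; apply/matrixP => i j; rewrite ord1 [RHS]mxE; apply/eqP.
  apply: contraT => rj0.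
  pose v : 'cV[R]_n := delta_mx j 0; set q := (v^T *m T *m v) 0 0.
  have rv : (r *m v) 0 0 = r 0 j by rewrite -colE mxE.
  have := qE (- (q + 1) / (r 0 j *+ 2)) v.
  rewrite a0 mul0r add0r rv -/q.
  suff -> : r 0 j * (- (q + 1) / (r 0 j *+ 2)) *+ 2 + q = - 1.
    by rewrite ler0N1.
  by field.
have [|B BE] := IHn (T - a^-1 *: (r^T *m r)).
  split; first by rewrite linearB/= linearZ/= trmx_mul trmxK symT.
  move=> v; apply: (le_trans (qE (- (r *m v) 0 0 / a) v)).
  rewrite le_eqVlt; apply/orP; left; apply/eqP.
  rewrite mulmxBr mulmxBl -scalemxAr -scalemxAl.
  have -> : v^T *m (r^T *m r) *m v = (r *m v)^T *m (r *m v).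
    by rewrite trmx_mul !mulmxA.
  rewrite [r *m v]mx11_scalar tr_scalar_mx -scalar_mxM !mxE !eqxx !mulr1n.
  have [->|an0] := eqVneq a 0; first by rewrite invr0; ring.
  by field.
pose s := Num.sqrt a.
pose B1 : 'M[R]_(1 + n) := block_mx s%:M 0 (s^-1 *: r^T) B.
exists B1; suff : B1 *m B1^T = S1 by [].
rewrite /B1 tr_block_mx mulmx_block !trmx0 !mulmx0 !mul0mx !addr0.
rewrite tr_scalar_mx linearZ/= trmxK -scalemxAr mul_scalar_mx.
rewrite -scalemxAl SE BE.
have ssa : s * s = a by rewrite -expr2 sqr_sqrtr.
have sr : s^-1 *: (s *: r) = r.
  rewrite scalerA; have [s0|s0] := eqVneq s 0; last by rewrite mulVf ?scale1r.
  by rewrite r0 ?scaler0// -ssa s0 mul0r.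
congr block_mx.
- by rewrite scale_scalar_mx ssa.
- by rewrite mul_scalar_mx sr.
- by rewrite mul_mx_scalar -[in RHS]sr; apply/matrixP => i j; rewrite !mxE.
- by rewrite -scalemxAl -scalemxAr scalerA -invfM ssa addrC subrK.
Qed.

Definition mx_factor {R : realType} n (S : 'M[R]_n) : 'M[R]_n :=
  xget 0 [set B | B *m B^T = S].

Lemma mx_factorP (R : realType) n (S : 'M[R]_n) :
  psdmx S -> mx_factor S *m (mx_factor S)^T = S.
Proof. by move=> /psdmx_factor; rewrite /mx_factor => /xgetPex. Qed.

Section gaussian.
Context {R : realType}.

Definition cons_cV n (p : measurableTypeR R * 'cV[R]_n) :
  'cV[R]_n.+1 := col_mx (p.1 : R)%:M p.2.

Lemma measurable_cons_cV n : measurable_fun setT (@cons_cV n).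
Proof.
apply/measurable_fun_matrixP => i j; rewrite /cons_cV.
case: (@split_ordP 1 n i) => k ->.
  apply: (@eq_measurable_fun _ _ _ _ setT
    (fst : measurableTypeR R * 'cV[R]_n -> R)) => [x _|].
    by rewrite (@col_mxEu _ 1) !ord1 mxE eqxx mulr1n.
  exact: measurable_fst.
apply: (@eq_measurable_fun _ _ _ _ setT
  (fun x : measurableTypeR R * 'cV[R]_n => x.2 k j)) => [x _|].
  by rewrite (@col_mxEd _ 1).
exact: (measurableT_comp (measurable_entry k j) measurable_snd).
Qed.

HB.instance Definition _ n :=
  isMeasurableFun.Build _ _ _ _ (@cons_cV n) (@measurable_cons_cV n).

(* Law of a column of n independent N(0, 1) variables. *)
Fixpoint std_gaussian n : probability 'cV[R]_n R :=
  match n with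
  | 0 => \d_(0 : 'cV[R]_0)
  | n'.+1 => distribution (normal_prob 0 1 \x std_gaussian n')%E (@cons_cV n')
  end.

Definition affine_map {n k} (mu : 'cV[R]_n) (B : 'M[R]_(n, k)) (z : 'cV[R]_k) :
  'cV[R]_n := mu + B *m z.

Lemma measurable_affine_map n k (mu : 'cV[R]_n) (B : 'M[R]_(n, k)) :
  measurable_fun setT (affine_map mu B).
Proof.
apply/measurable_fun_matrixP => i j.
under eq_fun do rewrite /affine_map !mxE.
apply: measurable_funD; first exact: measurable_cst.
by apply: measurable_sum => l; apply: measurable_funM;
  [exact: measurable_cst|exact: measurable_entry].
Qed.

HB.instance Definition _ n k (mu : 'cV[R]_n) (B : 'M[R]_(n, k)) :=
  isMeasurableFun.Build _ _ _ _ (affine_map mu B) (measurable_affine_map mu B).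

(* The law N(mu, S), for S positive semidefinite: the law of mu + B G with
   B *m B^T = S and G standard Gaussian; it does not depend on the choice of B.
   The library's normal_prob m s takes a standard deviation and is not a Dirac
   mass for s = 0, hence it is only used with s = 1. *)
Definition gaussian n (mu : 'cV[R]_n) (S : 'M[R]_n) : probability 'cV[R]_n R :=
  distribution (std_gaussian n) (affine_map mu (mx_factor S)).

End gaussian.

Definition is_gaussian {R : realType} {d} {T : measurableType d}
    (P : probability T R) n (X : {RV P >-> 'cV[R]_n})
    (mu : 'cV[R]_n) (S : 'M[R]_n) : Prop :=
  psdmx S /\
  forall E, measurable E -> distribution P X E = gaussian mu S E.

Arguments is_gaussian {R d T} P {n} X mu S.

Section gaussian_moments.
Context {R : realType} (sigma : R -> R).

Definition gaussian1 (mu nu : R) : probability 'cV[R]_1 R :=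
  gaussian mu%:M nu%:M.

Definition gaussian2 (mu1 mu2 nu11 nu22 nu12 : R) :
    probability 'cV[R]_(1 + 1) R :=
  gaussian (col_mx mu1%:M mu2%:M : 'cV[R]_(1 + 1))
    (block_mx nu11%:M nu12%:M nu12%:M nu22%:M : 'M[R]_(1 + 1)).

(* fine: these are real numbers, meaningful when the moments exist. *)
Definition Msig (mu nu : R) : R :=
  fine 'E_(gaussian1 mu nu)[(fun z => sigma (z 0 0))%R]%E.

Definition Ksig (mu1 mu2 nu11 nu22 nu12 : R) : R :=
  fine (covariance (gaussian2 mu1 mu2 nu11 nu22 nu12)
    (fun z => sigma (z 0 0)) (fun z => sigma (z 1 0))).

(* The mean of the second coordinate is irrelevant; it is taken to be 0. *)
Definition Lsig (mu1 nu11 nu22 nu12 : R) : R :=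
  fine (covariance (gaussian2 mu1 0 nu11 nu22 nu12)
    (fun z => sigma (z 0 0)) (fun z => z 1 0)).

End gaussian_moments.

Section random_vectors.
Context {R : realType} {d} {T : measurableType d} (P : probability T R).

Definition mean_vec n (Y : T -> 'cV[R]_n) : 'cV[\bar R]_n :=
  \col_i 'E_P[(fun w => Y w i 0)%R]%E.

Definition cov_mx n (Y : T -> 'cV[R]_n) : 'M[\bar R]_n :=
  \matrix_(i, j) covariance P (fun w => Y w i 0) (fun w => Y w j 0).

End random_vectors.

Definition g_layer {R : realType} (sigma : R -> R) m n (A : 'M[R]_(m, n))
    (b : 'cV[R]_m) (C : 'M[R]_(m, n)) (d : 'cV[R]_m) (x : 'cV[R]_n) : 'cV[R]_m :=
  map_mx sigma (A *m x + b) + C *m x + d.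

(* Main.v *)
(* The law of F G, for G standard Gaussian and F a matrix, depends only on the
   Gram matrix F F^T: multiplying F on the right by a rotation of two
   coordinates does not change the law, since a planar rotation is a product of
   shears, which preserve Lebesgue measure, and the density of the pair depends
   only on the norm; rotations bring the first row to (r, 0, ..., 0) with r >= 0,
   and then one peels off a row. Hence an affine image e + D X of
   X ~ N(mu, S) has law N(e + D mu, D S D^T). Applied to pairs of coordinates of
   A X + b and C X, this turns the four terms of the bilinear expansion of the
   covariance into K, L, L and the covariance of two linear forms, which follows
   by polarization from E x^2 = 1 for the standard normal law. *)

From HB Require Import structures.
Require Import Defs.
From mathcomp Require Import all_boot all_order all_algebra.
From mathcomp Require Import all_classical all_reals all_analysis.
From mathcomp Require Import ring lra.
From mathcomp Require Import measurable_realfun.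

Set Implicit Arguments.
Unset Strict Implicit.
Unset Printing Implicit Defensive.

Import Order.TTheory GRing.Theory Num.Theory.
Import numFieldNormedType.Exports.

Local Open Scope classical_set_scope.
Local Open Scope ring_scope.

(** * Integration against a normal law, and translation of Lebesgue measure *)

(** The Radon-Nikodym derivative of [normal_prob m s] and [normal_pdf m s] have the same integral
    over every measurable set, hence agree almost everywhere. *)
Lemma ge0_integral_normal_prob (R : realType) (m s : R) (f : R -> \bar R) :
  measurable_fun setT f -> (forall x, 0 <= f x)%E ->
  (\int[normal_prob m s]_x f x =
   \int[lebesgue_measure]_x (f x * (normal_pdf m s x)%:E))%E.
Proof.
move=> mf f0; have dom := normal_prob_dominates m s.
have mpdf : measurable_fun setT (fun x : R => (normal_pdf m s x)%:E).
  by apply/measurable_EFinP; exact: measurable_normal_pdf.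
rewrite -(Radon_Nikodym_SigmaFinite.change_of_variables dom)//.
have iRN := Radon_Nikodym_SigmaFinite.f_integrable dom.
have mRN := measurable_int _ iRN.
apply: ae_eq_integral => //.
- exact: emeasurable_funM.
- exact: emeasurable_funM.
- apply/ae_eqe_mul2l/integral_ae_eq => //.
  by move=> E _ mE; rewrite -Radon_Nikodym_SigmaFinite.f_integral.
Qed.

(** By uniqueness of Lebesgue measure: its pushforward under the shift gives every interval []x, y]]
    its length. *)
Lemma ge0_integral_lebesgue_shift (R : realType) (a : R) (f : R -> \bar R) :
  measurable_fun setT f -> (forall x, 0 <= f x)%E ->
  (\int[lebesgue_measure]_x f (x + a)%R = \int[lebesgue_measure]_x f x)%E.
Proof.
move=> mf f0.
pose sh (x : measurableTypeR R) : measurableTypeR R := x + a.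
have msh : measurable_fun setT sh by exact: measurable_funD.
transitivity (\int[pushforward lebesgue_measure sh]_x f x)%E.
  by rewrite ge0_integral_pushforward.
apply/esym/eq_measure_integral => A mA _.
pose mshP := isMeasurableFun.Build _ _ _ _ _ msh.
pose sh' : {mfun measurableTypeR R >-> measurableTypeR R} := HB.pack sh mshP.
apply: (@lebesgue_measure_unique R (pushforward lebesgue_measure sh')) => //.
move=> _ [[x y] _ <-].
rewrite /pushforward /= lebesgue_measure_itv/=.
rewrite [X in _ = lebesgue_measure X](_ : _ = `]x - a, y - a]%classic); last first.
  by apply/seteqP; split => z; rewrite /sh /= !in_itv/= ltrBlDr lerBrDr.
rewrite lebesgue_measure_itv/= !lte_fin ltrD2r; case: ifPn => // _.
by rewrite -!EFinD; congr _%:E; ring.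
Qed.

(** * Rotation invariance of Lebesgue measure on the plane *)

Section rotation_invariance_of_the_plane.
Context {R : realType}.
Implicit Types h : measurableTypeR R * measurableTypeR R -> \bar R.

Local Notation lam := (@lebesgue_measure R).

(** On each vertical line the shear is a translation. *)
Lemma ge0_integral_lebesgue2_shear a h :
  measurable_fun setT h -> (forall z, 0 <= h z)%E ->
  (\int[lam]_x \int[lam]_y h (x, (y + a * x)%R) =
   \int[lam]_x \int[lam]_y h (x, y))%E.
Proof.
move=> mh h0; apply: eq_integral => x _.
rewrite (ge0_integral_lebesgue_shift (a * x) (f := fun y => h (x, y)))//.
exact: measurable_fun_pair2.
Qed.

(* A rotation of angle theta <> pi is the product of three shears of slopes
   - tan (theta / 2), sin theta and - tan (theta / 2). *)
Lemma ge0_integral_lebesgue2_rotation c s h : c ^+ 2 + s ^+ 2 = 1 -> c != -1 ->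
  measurable_fun setT h -> (forall z, 0 <= h z)%E ->
  (\int[lam]_x \int[lam]_y h ((c * x - s * y)%R, (s * x + c * y)%R) =
   \int[lam]_x \int[lam]_y h (x, y))%E.
Proof.
move=> cs1 cN1 mh h0; pose t := s / (1 + c).
have c1 : 1 + c != 0 by rewrite addrC -(opprK 1) subr_eq0.
have mshear a k : measurable_fun setT k ->
    measurable_fun setT (fun z : measurableTypeR R * measurableTypeR R =>
      k (z.1, (z.2 + a * z.1)%R) : \bar R).
  move=> mk; apply: (measurableT_comp mk).
  apply: measurable_fun_pair => //; apply: measurable_funD => //.
  exact: measurable_funM.
have mswap k : measurable_fun setT k -> measurable_fun setT
    (fun z : measurableTypeR R * measurableTypeR R => k (z.2, z.1) : \bar R).
  by move=> mk; apply: (measurableT_comp mk); exact: measurable_fun_pair.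
(* Shears act on the second coordinate only. Each composition also swaps the coordinates, so that
   successive shears act along alternating axes. *)
pose h1 z := h ((z.2 + - t * z.1)%R, z.1).
have mh1 : measurable_fun setT h1 by exact: (mshear _ _ (mswap h mh)).
pose h2 z := h1 ((z.2 + s * z.1)%R, z.1).
have mh2 : measurable_fun setT h2 by exact: (mshear _ _ (mswap h1 mh1)).
pose h3 z := h2 ((z.2 + - t * z.1)%R, z.1).
have mh3 : measurable_fun setT h3 by exact: (mshear _ _ (mswap h2 mh2)).
(* Removes one shear together with its swap; the swap is undone by Tonelli's theorem. *)
have step a k : measurable_fun setT k -> (forall z, 0 <= k z)%E ->
    (\int[lam]_x \int[lam]_y k ((y + a * x)%R, x) =
     \int[lam]_x \int[lam]_y k (x, y))%E.
  move=> mk k0.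
  transitivity (\int[lam]_x \int[lam]_y k (y, x))%E.
    exact: (ge0_integral_lebesgue2_shear a (mswap k mk) (fun z => k0 _)).
  exact/esym/(@fubini_tonelli _ _ _ _ _ lam lam k mk k0).
(* Half-angle identities for t = tan (theta / 2). *)
have ts : t * s = 1 - c.
  have s2 : s ^+ 2 = 1 - c ^+ 2 by rewrite -cs1 addrC addKr.
  by rewrite /t mulrAC -expr2 s2; field.
have tc : t + t * c = s by rewrite /t; field.
(* The three swaps amount to a single one, whence the arguments in the order [(y, x)]. *)
transitivity (\int[lam]_x \int[lam]_y h3 (y, x))%E.
  apply: eq_integral => x _; apply: eq_integral => y _.
  rewrite /h3 /h2 /h1/=; congr (h (_, _)).
    transitivity (x - t * y *+ 2 - t * s * x + t * (t * s) * y); last by ring.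
    by rewrite ts -[in LHS]tc; ring.
  have -> : y + s * (x + - t * y) = y + s * x - t * s * y by ring.
  by rewrite ts; ring.
transitivity (\int[lam]_x \int[lam]_y h3 (x, y))%E.
  exact/esym/(@fubini_tonelli _ _ _ _ _ lam lam h3 mh3 (fun z => h0 _)).
transitivity (\int[lam]_x \int[lam]_y h2 (x, y))%E.
  exact: (step (- t) h2 mh2 (fun z => h0 _)).
transitivity (\int[lam]_x \int[lam]_y h1 (x, y))%E.
  exact: (step s h1 mh1 (fun z => h0 _)).
exact: (step (- t) h mh h0).
Qed.

End rotation_invariance_of_the_plane.

(** * Rotation invariance of a pair of independent standard normal variables *)

Section standard_normal.
Context {R : realType}.

Local Notation lam := (@lebesgue_measure R).
Let N01 : probability (measurableTypeR R) R := normal_prob 0 1.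

Lemma ge0_integral_std_normal2 (h : measurableTypeR R * measurableTypeR R -> \bar R) :
  measurable_fun setT h -> (forall z, 0 <= h z)%E ->
  (\int[N01]_x \int[N01]_y h (x, y) =
   \int[lam]_x \int[lam]_y (h (x, y) * (normal_pdf 0 1 x * normal_pdf 0 1 y)%:E))%E.
Proof.
move=> mh h0.
have mpdf : measurable_fun setT (fun x : R => (normal_pdf 0 1 x)%:E).
  by apply/measurable_EFinP; exact: measurable_normal_pdf.
rewrite ge0_integral_normal_prob; last 2 first.
- exact: measurable_fun_fubini_tonelli_F.
- by move=> x; exact: integral_ge0.
apply: eq_integral => x _.
rewrite ge0_integral_normal_prob//; last exact: measurable_fun_pair2.
rewrite -ge0_integralZr//; last 3 first.
- by apply: emeasurable_funM => //; exact: measurable_fun_pair2.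
- by move=> y _; rewrite mule_ge0// lee_fin normal_pdf_ge0.
- by rewrite lee_fin normal_pdf_ge0.
by apply: eq_integral => y _; rewrite EFinM -muleA [(_%:E * _)%E in LHS]muleC.
Qed.

(** The exponents add up to a function of x^2 + y^2, which a rotation preserves. *)
Lemma normal_pdf01_rotation (c s x y : R) : c ^+ 2 + s ^+ 2 = 1 ->
  normal_pdf 0 1 (c * x - s * y) * normal_pdf 0 1 (s * x + c * y) =
  normal_pdf 0 1 x * normal_pdf 0 1 y.
Proof.
move=> cs1; rewrite normal_pdfE ?oner_eq0// mulrACA [RHS]mulrACA /normal_fun -!expRD.
congr (_ * expR _); rewrite !subr0 -!mulrDl; congr (_ / _).
by rewrite -!opprD; congr (- _); rewrite -[RHS]mul1r -cs1; ring.
Qed.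

Let std_normal2_rotation_aux c s (h : measurableTypeR R * measurableTypeR R -> \bar R) :
  c ^+ 2 + s ^+ 2 = 1 -> c != -1 ->
  measurable_fun setT h -> (forall z, 0 <= h z)%E ->
  (\int[N01]_x \int[N01]_y h ((c * x - s * y)%R, (s * x + c * y)%R) =
   \int[N01]_x \int[N01]_y h (x, y))%E.
Proof.
move=> cs1 cN1 mh h0.
have mpdf : measurable_fun setT (@normal_pdf R 0 1) := measurable_normal_pdf 0 1.
pose hr z := h (c * z.1 - s * z.2, s * z.1 + c * z.2).
have mhr : measurable_fun setT hr.
  apply: (measurableT_comp mh); apply: measurable_fun_pair => //=.
    by apply: measurable_funB; apply: measurable_funM.
  by apply: measurable_funD; apply: measurable_funM.
(* Including the joint density in the integrand reduces the claim to Lebesgue measure; the density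
   is itself rotation invariant. *)
pose k z := (h z * (normal_pdf 0 1 z.1 * normal_pdf 0 1 z.2)%:E)%E.
have mk : measurable_fun setT k.
  apply: emeasurable_funM => //; apply/measurable_EFinP.
  by apply: measurable_funM; exact: measurableT_comp.
have k0 z : (0 <= k z)%E.
  by rewrite mule_ge0// lee_fin mulr_ge0 ?normal_pdf_ge0.
transitivity (\int[lam]_x \int[lam]_y k (x, y))%E; last first.
  exact/esym/(ge0_integral_std_normal2 mh h0).
transitivity (\int[lam]_x \int[lam]_y k (c * x - s * y, s * x + c * y)%R)%E; last first.
  exact: (ge0_integral_lebesgue2_rotation cs1 cN1 mk k0).
transitivity (\int[lam]_x \int[lam]_y
  (hr (x, y) * (normal_pdf 0 1 x * normal_pdf 0 1 y)%:E))%E.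
  exact: (ge0_integral_std_normal2 mhr (fun z => h0 _)).
apply: eq_integral => x _; apply: eq_integral => y _.
by congr (h _ * _%:E)%E; exact/esym/normal_pdf01_rotation.
Qed.

Lemma ge0_integral_std_normal2_rotation c s
    (h : measurableTypeR R * measurableTypeR R -> \bar R) :
  c ^+ 2 + s ^+ 2 = 1 -> measurable_fun setT h -> (forall z, 0 <= h z)%E ->
  (\int[N01]_x \int[N01]_y h ((c * x - s * y)%R, (s * x + c * y)%R) =
   \int[N01]_x \int[N01]_y h (x, y))%E.
Proof.
move=> cs1 mh h0; have [cN1|] := eqVneq c (-1); last first.
  by move=> cN1; exact: std_normal2_rotation_aux.
(* The case excluded by the shear decomposition is the half turn. It is the square of the quarter
   turn [r], for which c = 0. *)
have s0 : s = 0.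
  apply/eqP; rewrite -sqrf_eq0; apply/eqP/(addrI 1).
  by rewrite addr0 -[RHS]cs1 cN1 sqrrN expr1n.
pose r (z : measurableTypeR R * measurableTypeR R) :
  measurableTypeR R * measurableTypeR R := (- z.2, z.1).
have mr : measurable_fun setT r.
  by apply: measurable_fun_pair => //; exact: measurableT_comp.
have rot90 k : measurable_fun setT k -> (forall z, 0 <= k z)%E ->
  (\int[N01]_x \int[N01]_y k (r (x, y)) = \int[N01]_x \int[N01]_y k (x, y))%E.
  move=> mk k0.
  rewrite -[RHS](@std_normal2_rotation_aux 0 1 k _ _ mk k0).
  - apply: eq_integral => x _; apply: eq_integral => y _ /=.
    by rewrite /r !mul0r !mul1r addr0 sub0r.
  - by rewrite expr0n expr1n add0r.
  - by rewrite eq_sym oppr_eq0 oner_eq0.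
transitivity (\int[N01]_x \int[N01]_y (h \o r) (r (x, y)))%E.
  apply: eq_integral => x _; apply: eq_integral => y _ /=.
  by rewrite /r/= cN1 s0 !mulN1r !mul0r subr0 add0r.
transitivity (\int[N01]_x \int[N01]_y (h \o r) (x, y))%E.
  by apply: (rot90 (h \o r)) => [|z]; [exact: measurableT_comp|exact: h0].
exact: rot90.
Qed.

End standard_normal.

(** * The law of F G is determined by the Gram matrix of F *)

Section standard_gaussian.
Context {R : realType}.
Local Notation N01 := (@normal_prob R 0 1).

Lemma measurable_mulmx m n (F : 'M[R]_(m, n)) :
  measurable_fun setT (fun v : 'cV[R]_n => F *m v).
Proof.
apply: (eq_measurable_fun (affine_map 0 F)) => [v _|].
  by rewrite /affine_map add0r.
exact: measurable_affine_map.
Qed.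

Lemma ge0_integral_std_gaussianS n (f : 'cV[R]_n.+1 -> \bar R) :
  measurable_fun setT f -> (forall v, 0 <= f v)%E ->
  (\int[std_gaussian n.+1]_v f v =
   \int[N01]_x \int[std_gaussian n]_v f (cons_cV (x, v)))%E.
Proof.
move=> mf f0; rewrite /= ge0_integral_distribution// fubini_tonelli1//.
  by apply: measurableT_comp => //; exact: measurable_cons_cV.
by move=> z; exact: f0.
Qed.

Lemma mul_row_cons_cV m n (c : 'cV[R]_m) (F : 'M[R]_(m, n)) x v :
  row_mx c F *m cons_cV (x, v) = x *: c + F *m v.
Proof. by rewrite mul_row_col mul_mx_scalar. Qed.

(** Nonnegative test functions have integrals without integrability conditions. The numbers of
    columns may differ, which leaves room for padding. *)
Definition same_law m n n' (F : 'M[R]_(m, n)) (F' : 'M[R]_(m, n')) :=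
  forall f : 'cV[R]_m -> \bar R,
    measurable_fun setT f -> (forall v, 0 <= f v)%E ->
  (\int[std_gaussian n]_v f (F *m v) = \int[std_gaussian n']_v f (F' *m v))%E.

Lemma same_law_trans m n1 n2 n3 (F1 : 'M[R]_(m, n1)) (F2 : 'M[R]_(m, n2))
    (F3 : 'M[R]_(m, n3)) :
  same_law F1 F2 -> same_law F2 F3 -> same_law F1 F3.
Proof. by move=> F12 F23 f mf f0; rewrite F12// F23. Qed.

Lemma same_law_sym m n n' (F : 'M[R]_(m, n)) (F' : 'M[R]_(m, n')) :
  same_law F F' -> same_law F' F.
Proof. by move=> FF' f mf f0; rewrite FF'. Qed.

Lemma ge0_integral_std_gaussian_row_mx m n (c : 'cV[R]_m) (F : 'M[R]_(m, n))
    (f : 'cV[R]_m -> \bar R) :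
  measurable_fun setT f -> (forall v, 0 <= f v)%E ->
  (\int[std_gaussian (1 + n)]_v f (row_mx c F *m v) =
   \int[N01]_x \int[std_gaussian n]_v f (x *: c + F *m v)%R)%E.
Proof.
move=> mf f0.
transitivity (\int[N01]_x \int[std_gaussian n]_v
    f (row_mx c F *m cons_cV (x, v)))%E; last first.
  apply: eq_integral => x _; apply: eq_integral => v _.
  by rewrite mul_row_cons_cV.
apply: (@ge0_integral_std_gaussianS n (fun v => f (row_mx c F *m v))) => //.
exact: (measurableT_comp mf (measurable_mulmx _)).
Qed.

Lemma measurable_fun_shift_mulmx m k (c : 'cV[R]_m) (F : 'M[R]_(m, k))
    (f : 'cV[R]_m -> \bar R) :
  measurable_fun setT f -> measurable_fun setT (fun v => f (c + F *m v)).
Proof.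
by move=> mf; apply: (measurableT_comp mf); exact: (measurable_affine_map c F).
Qed.

(** The added Gaussian coordinate is multiplied by 0, so the outer integral is that of a constant
    against a probability. *)
Lemma same_law_pad m n (F : 'M[R]_(m, n)) : same_law F (row_mx (0 : 'cV_m) F).
Proof.
move=> f mf f0; rewrite ge0_integral_std_gaussian_row_mx//.
under [RHS]eq_integral do under eq_integral do rewrite scaler0 add0r.
set k := (X in X = _).
transitivity (k * N01 [set: measurableTypeR R])%E.
  by rewrite [N01 _](probability_setT N01) mule1.
exact/esym/(integral_cst N01 measurableT k).
Qed.

Lemma same_law_affine m m' n n' (F : 'M[R]_(m, n)) (F' : 'M[R]_(m, n'))
    (c : 'cV[R]_m') (G : 'M[R]_(m', m)) (f : 'cV[R]_m' -> \bar R) :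
  same_law F F' -> measurable_fun setT f -> (forall v, 0 <= f v)%E ->
  (\int[std_gaussian n]_v f (c + G *m (F *m v))%R =
   \int[std_gaussian n']_v f (c + G *m (F' *m v))%R)%E.
Proof.
move=> FF' mf f0; apply: (FF' (fun v => f (c + G *m v))) => //.
exact: measurable_fun_shift_mulmx.
Qed.

(** For each value of the coordinate multiplying [c], what remains is a translate of F G. *)
Lemma same_law_row_mx m n n' (c : 'cV[R]_m) (F : 'M[R]_(m, n))
    (F' : 'M[R]_(m, n')) :
  same_law F F' -> same_law (row_mx c F) (row_mx c F').
Proof.
move=> FF' f mf f0; rewrite !ge0_integral_std_gaussian_row_mx//.
apply: eq_integral => x _; under eq_integral do rewrite -[F *m _]mul1mx.
under [RHS]eq_integral do rewrite -[F' *m _]mul1mx.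
exact: same_law_affine.
Qed.

Lemma same_law_mull m m' n n' (G : 'M[R]_(m', m)) (F : 'M[R]_(m, n))
    (F' : 'M[R]_(m, n')) :
  same_law F F' -> same_law (G *m F) (G *m F').
Proof.
move=> FF' f mf f0; under eq_integral do rewrite -mulmxA -[G *m _]add0r.
under [RHS]eq_integral do rewrite -mulmxA -[G *m _]add0r.
exact: same_law_affine.
Qed.

(** Rotating two columns amounts to rotating their coefficients: x (c f1 + s f2) + y (c f2 - s f1) =
    (c x - s y) f1 + (s x + c y) f2. *)
Lemma same_law_rotation m n (c s : R) (f1 f2 : 'cV[R]_m) (F : 'M[R]_(m, n)) :
  c ^+ 2 + s ^+ 2 = 1 ->
  same_law (row_mx f1 (row_mx f2 F))
    (row_mx (c *: f1 + s *: f2) (row_mx (c *: f2 - s *: f1) F)).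
Proof.
move=> cs1 f mf f0.
have E (g1 g2 : 'cV[R]_m) :
    (\int[std_gaussian (1 + (1 + n))]_v f (row_mx g1 (row_mx g2 F) *m v) =
     \int[N01]_x \int[N01]_y \int[std_gaussian n]_v f (x *: g1 + y *: g2 + F *m v)%R)%E.
  rewrite ge0_integral_std_gaussian_row_mx//; apply: eq_integral => x _.
  have mfx : measurable_fun setT (fun v => f (x *: g1 + v)).
    have := measurable_fun_shift_mulmx (x *: g1) 1%:M mf.
    by under eq_fun do rewrite mul1mx.
  apply: (etrans (ge0_integral_std_gaussian_row_mx g2 F mfx (fun v => f0 _))).
  by apply: eq_integral => y _; apply: eq_integral => v _; rewrite addrA.
rewrite !E.
(* The other coordinates are integrated out, which leaves a function of the pair to be rotated. *)
pose h (z : measurableTypeR R * measurableTypeR R) :=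
  (\int[std_gaussian n]_v f (z.1 *: f1 + z.2 *: f2 + F *m v)%R)%E.
have h0 z : (0 <= h z)%E by exact: integral_ge0.
have mh : measurable_fun setT h.
  apply: (@measurable_fun_fubini_tonelli_F _ _ _ _ _ (std_gaussian n)
    (fun z : (measurableTypeR R * measurableTypeR R) * 'cV[R]_n =>
      f (z.1.1 *: f1 + z.1.2 *: f2 + F *m z.2))) => //.
  apply: (@eq_measurable_fun _ _ _ _ setT
   (fun z : (measurableTypeR R * measurableTypeR R) * 'cV[R]_n =>
    f (row_mx f1 (row_mx f2 F) *m cons_cV (z.1.1, cons_cV (z.1.2, z.2))))) => [z _|].
    by rewrite !mul_row_cons_cV addrA.
  apply: (measurableT_comp mf); apply: (measurableT_comp (measurable_mulmx _)).
  apply: (measurableT_comp (@measurable_cons_cV R _)).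
  apply: measurable_fun_pair; first exact: measurableT_comp.
  apply: (measurableT_comp (@measurable_cons_cV R _)).
  by apply: measurable_fun_pair => //; exact: measurableT_comp.
transitivity (\int[N01]_x \int[N01]_y h (x, y))%E; first exact: erefl.
apply: etrans (esym (ge0_integral_std_normal2_rotation cs1 mh h0)) _.
apply: eq_integral => x _; apply: eq_integral => y _; apply: eq_integral => v _.
congr (f (_ + _)); apply/matrixP => i j; rewrite !mxE/=.
ring.
Qed.

Lemma rotate_to_axis (x y : R) : exists c s r : R,
  [/\ c ^+ 2 + s ^+ 2 = 1, 0 <= r, c * x + s * y = r & c * y - s * x = 0].
Proof.
pose r := Num.sqrt (x ^+ 2 + y ^+ 2).
have r2 : r ^+ 2 = x ^+ 2 + y ^+ 2 by rewrite sqr_sqrtr// addr_ge0// sqr_ge0.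
have [r0|r0] := eqVneq r 0.
  have /eqP := esym r2; rewrite r0 expr0n/= paddr_eq0 ?sqr_ge0// !sqrf_eq0.
  move=> /andP[/eqP -> /eqP ->]; exists 1, 0, 0; split=> //; try ring.
exists (x / r), (y / r), r; split.
- by rewrite !exprMn -mulrDl -r2 -exprMn divff// expr1n.
- exact: sqrtr_ge0.
- by apply: (mulIf r0); rewrite -[RHS]expr2 r2; field.
- by field.
Qed.

Lemma gram_row_mx m n (c : 'cV[R]_m) (F : 'M[R]_(m, n)) :
  row_mx c F *m (row_mx c F)^T = c *m c^T + F *m F^T.
Proof. by rewrite tr_row_mx mul_row_col. Qed.

(** Tracks the Gram matrix while [same_law_rotation] acts on the law. *)
Lemma gram_rotation m (c s : R) (f g : 'cV[R]_m) : c ^+ 2 + s ^+ 2 = 1 ->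
  (c *: f + s *: g) *m (c *: f + s *: g)^T +
  (c *: g - s *: f) *m (c *: g - s *: f)^T = f *m f^T + g *m g^T.
Proof.
move=> cs1; apply/matrixP => i j; rewrite !mxE !big_ord1 !mxE -[RHS]mul1r -cs1.
ring.
Qed.

(* Padding F with a null column makes room for a rotation that also normalizes
   the sign of the pivot r. *)
Lemma same_law_first_row m n (F : 'M[R]_(1 + m, n)) :
  exists (r : R) (f : 'cV[R]_m) (G : 'M[R]_(m, n)), [/\ 0 <= r,
    same_law F (row_mx (col_mx r%:M f) (col_mx 0 G)) &
    F *m F^T = col_mx r%:M f *m (col_mx r%:M f)^T + col_mx 0 G *m (col_mx 0 G)^T].
Proof.
suff [r [f [G [r0 FG FFT]]]] : exists (r : R) (f : 'cV[R]_m) (G : 'M[R]_(m, n)),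
    [/\ 0 <= r,
    same_law (row_mx (0 : 'cV_(1 + m)) F) (row_mx (col_mx r%:M f) (col_mx 0 G)) &
    F *m F^T = col_mx r%:M f *m (col_mx r%:M f)^T + col_mx 0 G *m (col_mx 0 G)^T].
  exists r, f, G; split=> //; exact: same_law_trans (same_law_pad F) FG.
elim: n F => [|n IHn] F.
  exists 0, 0, 0; split=> //.
    by rewrite raddf0 col_mx0 [F]thinmx0 [col_mx 0 _]thinmx0.
  by rewrite raddf0 col_mx0 mul0mx [F]thinmx0 [col_mx 0 _]thinmx0 add0r.
rewrite -[F](@hsubmxK _ _ 1 n); set f1 := lsubmx _; set F2 := rsubmx _.
(* The null column put before [F2] receives the pivot [r']; a rotation then merges it with the entry
   [x] of the first column. *)
have [r' [g [G [r'0 F2G F2F2T]]]] := IHn F2.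
rewrite -[f1]vsubmxK [usubmx _]mx11_scalar.
set x := usubmx f1 0 0; set h := dsubmx f1.
have [c [s [r [cs1 r0 cx cy]]]] := rotate_to_axis x r'.
have colE : c *: col_mx x%:M h + s *: col_mx r'%:M g = col_mx r%:M (c *: h + s *: g).
  by rewrite !scale_col_mx add_col_mx !scale_scalar_mx -raddfD/= cx.
have colE' : c *: col_mx r'%:M g - s *: col_mx x%:M h = col_mx 0 (c *: g - s *: h).
  by rewrite !scale_col_mx opp_col_mx add_col_mx !scale_scalar_mx -raddfB/= cy raddf0.
have rowE (u : 'cV[R]_m) (M : 'M[R]_(m, n)) :
    row_mx (col_mx (0 : 'M[R]_1) u) (col_mx (0 : 'M[R]_(1, n)) M) = col_mx 0 (row_mx u M).
  by rewrite -block_mxEh block_mxEv row_mx0.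
exists r, (c *: h + s *: g), (row_mx (c *: g - s *: h) G); split=> //.
- apply: (@same_law_trans _ _ _ _ _
    (row_mx (col_mx x%:M h) (row_mx (0 : 'cV[R]_(1 + m)) F2))).
    (* A quarter turn moves the null column past the first column of F. *)
    have := @same_law_rotation _ _ 0 1 0 (col_mx x%:M h) F2.
    rewrite expr0n expr1n add0r => /(_ erefl).
    by rewrite scaler0 scale1r add0r scale0r scale1r subr0.
  apply: same_law_trans (same_law_row_mx (col_mx x%:M h) F2G) _.
  have := same_law_rotation (col_mx x%:M h) (col_mx r'%:M g) (col_mx 0 G) cs1.
  by rewrite colE colE' rowE.
- rewrite -rowE !gram_row_mx F2F2T !addrA -colE -colE'.
  by rewrite gram_rotation.
Qed.

Lemma same_law_gram m n n' (F : 'M[R]_(m, n)) (F' : 'M[R]_(m, n')) :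
  F *m F^T = F' *m F'^T -> same_law F F'.
Proof.
elim: m n n' F F' => [|m IHm] n n' F F' FF'.
  (* In dimension 0 the only vector is 0. *)
  move=> f mf f0.
  have E k (G : 'M[R]_(0, k)) : (\int[std_gaussian k]_v f (G *m v) = f 0%R)%E.
    under eq_integral do rewrite [_ *m _]flatmx0.
    rewrite (integral_cst (std_gaussian k) measurableT).
    by rewrite [X in (_ * X)%E]probability_setT mule1.
  by rewrite !E.
have [r [f [G [r0 FG FFT]]]] := @same_law_first_row m n F.
have [r' [f' [G' [r'0 FG' FFT']]]] := @same_law_first_row m n' F'.
move: FF'; rewrite FFT FFT' !tr_col_mx !mul_col_row !trmx0 !mul0mx !mulmx0.
(* Blockwise, the Gram matrices give equal squares of the pivots, equal products r f, and equal sums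
   f f^T + G G^T. Nonnegativity then identifies the pivots. *)
rewrite !tr_scalar_mx !add_block_mx !addr0 !mul_scalar_mx !mul_mx_scalar.
move=> /(@eq_block_mx _ 1 m 1 m)[rr' _ rf ff].
have {}rr' : r = r'.
  apply/eqP; rewrite -(@eqrXn2 _ 2)// !expr2; apply/eqP.
  by move/matrixP : rr' => /(_ 0 0); rewrite !mxE !eqxx !mulr1n.
apply: same_law_trans FG (same_law_trans _ (same_law_sym FG')).
rewrite -rr' in rf *.
(* A null pivot leaves [f] and [f'] unrelated, but the whole first row vanishes, so the induction
   hypothesis applies to the remaining rows with [f] and [f'] kept as columns. *)
have [r00|rn0] := eqVneq r 0.
  have E k (u : 'cV[R]_m) (M : 'M[R]_(m, k)) :
      row_mx (col_mx r%:M u) (col_mx 0 M) = col_mx 0 1%:M *m row_mx u M.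
    rewrite mul_col_mx mul0mx mul1mx r00 raddf0.
    by rewrite -block_mxEh block_mxEv row_mx0.
  by rewrite !E; apply/same_law_mull/IHm; rewrite !gram_row_mx.
(* With r nonzero the first columns coincide; cancelling f f^T leaves equal Gram matrices for [G]
   and [G']. *)
have ff' : f = f' by apply: (scalerI rn0).
rewrite -ff' in ff *; apply: same_law_row_mx.
have E k (M : 'M[R]_(m, k)) : col_mx (0 : 'M[R]_(1, k)) M = col_mx 0 1%:M *m M.
  by rewrite mul_col_mx mul0mx mul1mx.
by rewrite (E _ G) (E _ G'); apply/same_law_mull/IHm/(addrI (f *m f^T)).
Qed.

End standard_gaussian.

(** * The second moment of the standard normal law *)

Section normal_second_moment.
Context {R : realType}.
Local Notation lam := (@lebesgue_measure R).
Local Notation phi := (@normal_pdf R 0 1).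

Lemma normal_pdf01E : phi = (fun x => normal_peak 1 * expR (- x ^+ 2 / 2)).
Proof.
apply/funext => x; rewrite normal_pdfE ?oner_eq0// /normal_fun subr0.
by rewrite expr1n.
Qed.

Lemma is_derive_normal_pdf01 (x : R) : is_derive x 1 phi (- (x * phi x)).
Proof.
rewrite normal_pdf01E; apply: is_derive_eq.
by rewrite /GRing.scale /=; field.
Qed.

Lemma cvg_normal_pdf01 : phi x @[x --> +oo%R] --> (0 : R).
Proof.
rewrite normal_pdf01E -[X in _ --> X](mulr0 (normal_peak 1)).
apply: cvgMl_tmp.
under eq_cvg do rewrite mulNr.
apply: (cvg_comp (fun x : R => x ^+ 2 / 2) (fun x => expR (- x))); last exact: cvgr_expR.
by apply: gt0_cvgMly; [rewrite invr_gt0|exact: cvgr_expr2].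
Qed.

(** The function - phi is a primitive of x phi(x) and vanishes at infinity. *)
Lemma integral_normal_pdf01_tail (a : R) : 0 <= a ->
  (\int[lam]_(x in `[a, +oo[) (x * phi x)%:E = (phi a)%:E)%E.
Proof.
move=> a0; have cphi : continuous phi.
  by apply: continuous_normal_pdf; rewrite oner_eq0.
rewrite (@ge0_continuous_FTC2y R (fun x => x * phi x) (\- phi) a 0).
- by rewrite sub0e -EFinN opprK.
- by move=> x ax; rewrite mulr_ge0 ?normal_pdf_ge0// (le_trans a0).
- apply: continuous_subspaceT => x; apply: cvgM; [exact: cvg_id|exact: cphi].
- by rewrite -[X in _ --> X]oppr0; apply: cvgN; exact: cvg_normal_pdf01.
- by move=> x _; apply: derivableN; have [] := is_derive_normal_pdf01 x.
- by apply: cvgN; apply: cvg_at_right_filter; exact: cphi.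
- move=> x _; rewrite derive1E deriveN; last by have [] := is_derive_normal_pdf01 x.
  by have [_ ->] := is_derive_normal_pdf01 x; rewrite opprK.
Qed.

(* Tonelli's theorem for x phi(x) over the cone |y| <= x, since
   phi(y) is the integral of x phi(x) over x >= |y|. *)
Lemma integral_sqr_normal_pdf01 : (\int[lam]_x (x ^+ 2 * phi x)%:E = 1)%E.
Proof.
have vol (x : R) :
    lebesgue_measure `[(- x)%R, x] = if 0 <= x then (2 * x)%:E else 0%E.
  rewrite lebesgue_measure_itv/= lte_fin; case: ltP => xx; case: leP => x0 //.
  - by rewrite -EFinD; congr _%:E; ring.
  - by exfalso; lra.
  - by congr _%:E; lra.
have mphi : measurable_fun setT phi := measurable_normal_pdf 0 1.
pose g (z : measurableTypeR R * measurableTypeR R) :=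
  if `|z.2| <= z.1 then (z.1 * phi z.1)%:E else 0%E.
have mg : measurable_fun setT g.
  apply: measurable_fun_ifT => //.
    apply: measurable_fun_ler => //; exact: measurableT_comp.
  apply/measurable_EFinP; apply: measurable_funM => //; exact: measurableT_comp.
have g0 z : (0 <= g z)%E.
  rewrite /g; case: ifPn => // zz.
  by rewrite lee_fin mulr_ge0 ?normal_pdf_ge0// (le_trans _ zz).
(* Integrating over x first leaves phi(|y|) = phi(y), of total mass 1. *)
have gyx : (\int[lam]_y \int[lam]_x g (x, y) = 1)%E.
  rewrite -(@integral_normal_pdf R 0 1); apply: eq_integral => y _.
  transitivity (\int[lam]_(x in `[`|y|%R, +oo[) (x * phi x)%:E)%E.
    rewrite [RHS]integral_mkcond; apply: eq_integral => x _.
    by rewrite patchE mem_setE in_itv/= andbT /g.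
  by rewrite integral_normal_pdf01_tail// normal_pdf01E real_normK// num_real.
(* Integrating over y first gives, for x >= 0, the factor 2 x, the length of [-x, x]. *)
have gxy : (\int[lam]_x \int[lam]_y g (x, y) =
    2%:E * \int[lam]_(x in [set x | (0 <= x)%R]) (x ^+ 2 * phi x)%:E)%E.
  have m0 : measurable [set x : R | 0 <= x] by rewrite -set_itvcy.
  rewrite -ge0_integralZl//; last 2 first.
  - apply/measurable_EFinP/measurable_funTS; apply: measurable_funM => //.
  - by move=> x _; rewrite lee_fin mulr_ge0 ?sqr_ge0 ?normal_pdf_ge0.
  rewrite -set_itvcy [RHS]integral_mkcond; apply: eq_integral => x _.
  transitivity (\int[lam]_(y in `[(- x)%R, x]) (cst (x * phi x)%:E) y)%E.
    rewrite [RHS]integral_mkcond; apply: eq_integral => y _.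
    by rewrite patchE mem_setE in_itv/= /g/= ler_norml.
  have mI : measurable (`[(- x)%R, x] : set (measurableTypeR R)) by exact: measurable_itv.
  apply: etrans (integral_cst lam mI _) _.
  apply: etrans (congr1 (mule _) (vol x)) _.
  rewrite patchE mem_setE in_itv/= andbT; case: ifPn => _; last by rewrite mule0.
  by rewrite -!EFinM; congr _%:E; ring.
(* The integrand is even, so the whole integral is twice the one over the half-line. *)
rewrite ge0_symfun_integralT.
- exact: etrans (esym gxy) (etrans (@fubini_tonelli _ _ _ _ _ lam lam g mg g0) gyx).
- by move=> x; rewrite mulr_ge0 ?sqr_ge0 ?normal_pdf_ge0.
- move=> x; apply: cvgM; first exact: exprn_continuous.
  by apply: continuous_normal_pdf; rewrite oner_eq0.
- by move=> x /=; rewrite normal_pdf01E sqrrN.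
Qed.

Lemma integral_sqr_std_normal :
  (\int[@normal_prob R 0 1]_x (x ^+ 2)%:E = 1)%E.
Proof.
rewrite ge0_integral_normal_prob; last 2 first.
- by apply/measurable_EFinP; exact: measurable_funX.
- by move=> x; rewrite lee_fin sqr_ge0.
by rewrite -integral_sqr_normal_pdf01; apply: eq_integral => x _; rewrite EFinM.
Qed.

End normal_second_moment.

(** * Affine images of Gaussian vectors *)

(** The integral is the difference of those of the two parts, whatever their values; this carries
    identities for nonnegative integrands over to signed ones. *)
Lemma integral_eq_funeposneg d d' (T : measurableType d) (T' : measurableType d')
    (R : realType) (P : {measure set T -> \bar R}) (Q : {measure set T' -> \bar R})
    (U : Type) (X : T -> U) (Y : T' -> U) (f : U -> \bar R) :
  (\int[P]_x f^\+ (X x) = \int[Q]_y f^\+ (Y y))%E ->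
  (\int[P]_x f^\- (X x) = \int[Q]_y f^\- (Y y))%E ->
  (\int[P]_x f (X x) = \int[Q]_y f (Y y))%E.
Proof.
move=> fp fn; apply: etrans (integralE P _ _) _; apply/esym.
apply: etrans (integralE Q _ _) _.
rewrite (funepos_comp f X) (funepos_comp f Y) (funeneg_comp f X) (funeneg_comp f Y).
by congr (_ - _)%E; apply/esym; [exact: fp|exact: fn].
Qed.

Section gaussian_laws.
Context {R : realType}.

Lemma integral_same_gram m n n' (F : 'M[R]_(m, n)) (F' : 'M[R]_(m, n'))
    (f : 'cV[R]_m -> \bar R) :
  F *m F^T = F' *m F'^T -> measurable_fun setT f ->
  (\int[std_gaussian n]_v f (F *m v) = \int[std_gaussian n']_v f (F' *m v))%E.
Proof.
move=> /same_law_gram FF' mf.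
by apply: integral_eq_funeposneg; apply: FF' => //;
  [exact: measurable_funepos|exact: measurable_funeneg].
Qed.

Lemma integral_distribution_measurable d d' (T : measurableType d)
    (T' : measurableType d') (P : probability T R) (X : {RV P >-> T'})
    (f : T' -> \bar R) :
  measurable_fun setT f ->
  (\int[distribution P X]_y f y = \int[P]_x f (X x))%E.
Proof.
move=> mf; apply: (@integral_eq_funeposneg _ _ _ _ _ _ _ _ id X f).
  by apply: ge0_integral_distribution => //; exact: measurable_funepos.
by apply: ge0_integral_distribution => //; exact: measurable_funeneg.
Qed.

Lemma integral_gaussian n (mu : 'cV[R]_n) (S : 'M[R]_n) (f : 'cV[R]_n -> \bar R) :
  measurable_fun setT f ->
  (\int[gaussian mu S]_x f x = \int[std_gaussian n]_v f (mu + mx_factor S *m v)%R)%E.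
Proof. exact: integral_distribution_measurable. Qed.

Lemma psdmx_congruence m n (D : 'M[R]_(m, n)) (S : 'M[R]_n) :
  psdmx S -> psdmx (D *m S *m D^T).
Proof.
move=> [symS psdS]; split; first by rewrite !trmx_mul trmxK symS mulmxA.
by move=> v; have := psdS (D^T *m v); rewrite trmx_mul trmxK !mulmxA.
Qed.

(** The form l G has the law of |l| times one standard normal variable, the Gram matrix being |l|^2
    in both cases. *)
Lemma ge0_integral_sqr_std_gaussian n (l : 'rV[R]_n) :
  (\int[std_gaussian n]_v (((l *m v) 0 0) ^+ 2)%:E = ((l *m l^T) 0 0)%:E)%E.
Proof.
pose f (u : 'cV[R]_1) := ((u 0 0) ^+ 2)%:E.
have mf : measurable_fun setT f.
  by apply/measurable_EFinP; apply: measurable_funX; exact: measurable_entry.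
have f0 u : (0 <= f u)%E by rewrite lee_fin sqr_ge0.
pose a := Num.sqrt ((l *m l^T) 0 0).
have a2 : a ^+ 2 = (l *m l^T) 0 0.
  rewrite sqr_sqrtr// mxE sumr_ge0// => i _.
  by rewrite mxE -expr2 sqr_ge0.
(* The shape [1 + 0] allows the single column to be peeled off, leaving an empty block. *)
pose F : 'M[R]_(1, 1 + 0) := row_mx a%:M 0.
have lF : l *m l^T = F *m F^T.
  rewrite gram_row_mx mul0mx addr0 tr_scalar_mx -scalar_mxM -expr2 a2.
  exact: mx11_scalar.
transitivity (\int[std_gaussian (1 + 0)]_v f (F *m v))%E.
  exact: (same_law_gram lF mf f0).
apply: etrans (ge0_integral_std_gaussian_row_mx _ _ mf f0) _.
transitivity (\int[@normal_prob R 0 1]_x ((a ^+ 2)%:E * (x ^+ 2)%:E))%E.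
  apply: eq_integral => x _.
  under eq_integral do rewrite /f mul0mx addr0 !mxE eqxx mulr1n exprMn mulrC EFinM.
  by apply: etrans (integral_cst (std_gaussian 0) measurableT _) _;
    rewrite [X in (_ * X)%E]probability_setT mule1.
rewrite ge0_integralZl//; last 3 first.
- by apply/measurable_EFinP; exact: measurable_funX.
- by move=> x _; rewrite lee_fin sqr_ge0.
- by rewrite lee_fin sqr_ge0.
by rewrite a2 [X in (_ * X)%E]integral_sqr_std_normal mule1.
Qed.

Lemma Lfun2_sqr_lty d (T : measurableType d) (P : probability T R) (f : T -> R) :
  measurable_fun setT f -> (\int[P]_x ((f x) ^+ 2)%:E < +oo)%E ->
  f \in Lfun P 2%:E.
Proof.
move=> mf foo; rewrite inE; apply/andP; split; rewrite inE//=.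
rewrite /finite_norm unlock poweR_lty//.
apply: le_lt_trans foo; rewrite le_eqVlt; apply/orP; left; apply/eqP.
apply: eq_integral => x _ /=; rewrite powR_mulrn ?normr_ge0//.
by rewrite real_normK// num_real.
Qed.

Context {d} {T : measurableType d} {P : probability T R} {n : nat}.
Context (X : {RV P >-> 'cV[R]_n}) (mu : 'cV[R]_n) (S : 'M[R]_n).
Context (gX : is_gaussian P X mu S).

Lemma integral_is_gaussian (f : 'cV[R]_n -> \bar R) :
  measurable_fun setT f ->
  (\int[P]_w f (X w) = \int[std_gaussian n]_v f (mu + mx_factor S *m v)%R)%E.
Proof.
move=> mf; rewrite -integral_distribution_measurable// -integral_gaussian//.
by apply: eq_measure_integral => A mA _; exact: gX.2.
Qed.

(** With B = [mx_factor S], the image is e + D mu + (D B) G in law, and D B has the same Gram matrix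
    D S D^T as the factor chosen for that covariance. *)
Lemma integral_affine_gaussian m (e : 'cV[R]_m) (D : 'M[R]_(m, n))
    (f : 'cV[R]_m -> \bar R) :
  measurable_fun setT f ->
  (\int[P]_w f (e + D *m X w)%R =
   \int[gaussian (e + D *m mu) (D *m S *m D^T)]_x f x)%E.
Proof.
move=> mf; pose h v := f (e + D *m mu + v).
have mh : measurable_fun setT h.
  have := measurable_fun_shift_mulmx (e + D *m mu) 1%:M mf.
  by under eq_fun do rewrite mul1mx.
have psdD := psdmx_congruence D gX.1.
transitivity (\int[std_gaussian n]_v h (D *m mx_factor S *m v))%E.
  apply: etrans (integral_is_gaussian (measurable_fun_shift_mulmx e D mf)) _.
  by apply: eq_integral => v _; rewrite /h mulmxDr addrA mulmxA.
apply: etrans (esym (integral_gaussian _ _ mf)).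
apply: (integral_same_gram _ mh).
by rewrite mx_factorP// trmx_mul mulmxA -(mulmxA D) mx_factorP//; exact: gX.1.
Qed.

Lemma expectation_affine_gaussian m (e : 'cV[R]_m) (D : 'M[R]_(m, n))
    (f : 'cV[R]_m -> R) :
  measurable_fun setT f ->
  ('E_P[(fun w => f (e + D *m X w))%R] =
   'E_(gaussian (e + D *m mu)%R (D *m S *m D^T)%R)[f])%E.
Proof.
move=> mf; rewrite !unlock; apply: (integral_affine_gaussian e D (f := EFin \o f)).
exact/measurable_EFinP.
Qed.

Lemma covariance_affine_gaussian m (e : 'cV[R]_m) (D : 'M[R]_(m, n))
    (f g : 'cV[R]_m -> R) :
  measurable_fun setT f -> measurable_fun setT g ->
  covariance P (fun w => f (e + D *m X w)) (fun w => g (e + D *m X w)) =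
  covariance (gaussian (e + D *m mu) (D *m S *m D^T)) f g.
Proof.
move=> mf mg; rewrite covariance.unlock.
rewrite (expectation_affine_gaussian e D mf) (expectation_affine_gaussian e D mg).
(* Once both means are transferred they are mere constants, and the covariance is the expectation of
   one function. *)
set a := fine _; set b := fine _.
apply: (expectation_affine_gaussian e D (f := fun x => (f x - a) * (g x - b))).
by apply: measurable_funM; apply: measurable_funB.
Qed.

Lemma expectation_linear_gaussian (l : 'rV[R]_n) (a : R) (f : R -> R) :
  measurable_fun setT f ->
  ('E_P[(fun w => f ((l *m X w) 0 0 + a))%R] =
   'E_(gaussian1 ((l *m mu) 0 0 + a)%R ((l *m S *m l^T) 0 0)%R)
     [(fun z => f (z 0 0))%R])%E.
Proof.
move=> mf; have mfz : measurable_fun setT (fun z : 'cV[R]_1 => f (z 0 0)).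
  by apply: (measurableT_comp mf); exact: measurable_entry.
have h := expectation_affine_gaussian a%:M l mfz.
rewrite [l *m mu]mx11_scalar -raddfD/= [a + _]addrC [l *m S *m l^T]mx11_scalar in h.
apply: etrans h; congr expectation.
by apply/funext => w; rewrite [in RHS]mxE [a%:M _ _]mxE eqxx mulr1n addrC.
Qed.

(** Stacking [l] over [k] makes the pair an affine image of [X] in dimension two. *)
Lemma covariance_linear_gaussian (l k : 'rV[R]_n) (a c : R) (f g : R -> R) :
  measurable_fun setT f -> measurable_fun setT g ->
  covariance P (fun w => f ((l *m X w) 0 0 + a)) (fun w => g ((k *m X w) 0 0 + c)) =
  covariance (gaussian2 ((l *m mu) 0 0 + a) ((k *m mu) 0 0 + c)
      ((l *m S *m l^T) 0 0) ((k *m S *m k^T) 0 0) ((l *m S *m k^T) 0 0))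
    (fun z => f (z 0 0)) (fun z => g (z 1 0)).
Proof.
move=> mf mg.
have mfz : measurable_fun setT (fun z : 'cV[R]_(1 + 1) => f (z 0 0)).
  by apply: (measurableT_comp mf); exact: measurable_entry.
have mgz : measurable_fun setT (fun z : 'cV[R]_(1 + 1) => g (z 1 0)).
  by apply: (measurableT_comp mg); exact: measurable_entry.
pose e : 'cV[R]_(1 + 1) := col_mx a%:M c%:M.
pose D : 'M[R]_(1 + 1, n) := col_mx l k.
have DvE (v : 'cV[R]_n) :
    e + D *m v = col_mx ((l *m v) 0 0 + a)%:M ((k *m v) 0 0 + c)%:M.
  rewrite /e /D mul_col_mx add_col_mx [l *m v]mx11_scalar [k *m v]mx11_scalar.
  by rewrite -!raddfD/= [a + _]addrC [c + _]addrC !mxE eqxx !mulr1n.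
(* Symmetry of [S] makes the two off-diagonal entries equal, as [gaussian2] requires. *)
have kSl : k *m S *m l^T = (l *m S *m k^T)^T.
  by rewrite !trmx_mul trmxK gX.1.1 mulmxA.
have DSD : D *m S *m D^T = block_mx ((l *m S *m l^T) 0 0)%:M
    ((l *m S *m k^T) 0 0)%:M ((l *m S *m k^T) 0 0)%:M ((k *m S *m k^T) 0 0)%:M.
  rewrite /D tr_col_mx !mul_col_mx !mul_mx_row -block_mxEv.
  by congr block_mx; rewrite ?kSl [LHS]mx11_scalar// mxE.
have h := covariance_affine_gaussian e D mfz mgz.
have zu (u v : R) : (col_mx u%:M v%:M : 'cV[R]_(1 + 1)) 0 0 = u.
  transitivity ((col_mx u%:M v%:M : 'cV[R]_(1 + 1)) (lshift 1 0) 0).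
    by congr (fun_of_matrix _ _ _); exact: val_inj.
  by rewrite col_mxEu mxE.
have zd (u v : R) : (col_mx u%:M v%:M : 'cV[R]_(1 + 1)) 1 0 = v.
  transitivity ((col_mx u%:M v%:M : 'cV[R]_(1 + 1)) (rshift 1 0) 0).
    by congr (fun_of_matrix _ _ _); exact: val_inj.
  by rewrite col_mxEd mxE.
rewrite DvE DSD in h; apply: etrans h; congr covariance; apply/funext => w.
  by rewrite DvE zu.
by rewrite DvE zd.
Qed.

(** * Moments of centred linear forms *)

Definition centered_linear (l : 'rV[R]_n) (w : T) : R := (l *m (X w - mu)) 0 0.

Lemma measurable_linear_centering (l : 'rV[R]_n) :
  measurable_fun setT (fun u : 'cV[R]_n => (l *m (u - mu)) 0 0).
Proof.
apply: (eq_measurable_fun (fun u => (affine_map (- (l *m mu)) l u) 0 0)).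
  by move=> u _; rewrite /affine_map mulmxBr addrC.
apply: (measurableT_comp (measurable_entry 0 0)).
exact: measurable_affine_map.
Qed.

Lemma measurable_centered_linear l : measurable_fun setT (centered_linear l).
Proof. exact: (measurableT_comp (measurable_linear_centering l)). Qed.

(** In law the form is (l B) G with B B^T = S, whose second moment is the Gram matrix of l B. *)
Lemma expectation_centered_linear_sqr l :
  ('E_P[(centered_linear l ^+ 2)%R] = ((l *m S *m l^T) 0 0)%:E)%E.
Proof.
pose f (u : 'cV[R]_n) := (((l *m (u - mu)) 0 0) ^+ 2)%:E.
have mf : measurable_fun setT f.
  apply/measurable_EFinP; apply: measurable_funX.
  exact: measurable_linear_centering.
have -> : l *m S *m l^T = (l *m mx_factor S) *m (l *m mx_factor S)^T.
  by rewrite trmx_mul mulmxA -[in RHS](mulmxA l) mx_factorP//; exact: gX.1.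
rewrite unlock; apply: etrans (integral_is_gaussian mf) _.
rewrite -ge0_integral_sqr_std_gaussian; apply: eq_integral => v _.
by rewrite /f addrC addKr mulmxA.
Qed.

Lemma Lfun2_centered_linear l : centered_linear l \in Lfun P 2%:E.
Proof.
apply: Lfun2_sqr_lty; first exact: measurable_centered_linear.
have := expectation_centered_linear_sqr l; rewrite unlock => h.
by apply: le_lt_trans (ltry ((l *m S *m l^T) 0 0)); rewrite -h.
Qed.

(* l *m (X - mu) and - l *m (X - mu) have the same law. *)
Lemma expectation_centered_linear l : ('E_P[centered_linear l] = 0)%E.
Proof.
have Pfin : P setT \is a fin_num := fin_num_measure P _ measurableT.
have L1 k : centered_linear k \in Lfun P 1.
  exact/(Lfun_subset12 Pfin)/Lfun2_centered_linear.
have fE := expectation_fin_num (L1 l).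
have linE k : ('E_P[centered_linear k] =
    \int[std_gaussian n]_v (((k *m mx_factor S) *m v) 0 0)%:E)%E.
  pose f (u : 'cV[R]_n) := ((k *m (u - mu)) 0 0)%:E.
  have mf : measurable_fun setT f.
    by apply/measurable_EFinP; exact: measurable_linear_centering.
  rewrite unlock; apply: etrans (integral_is_gaussian mf) _.
  by apply: eq_integral => v _; rewrite /f addrC addKr mulmxA.
have EN : ('E_P[centered_linear (- l)%R] = - 'E_P[centered_linear l])%E.
  rewrite -[RHS]mulN1e -expectationZl//; congr expectation.
  by apply/funext => w; rewrite /centered_linear /= mulNmx mxE mulrN1.
have : ('E_P[centered_linear (- l)%R] = 'E_P[centered_linear l])%E.
  rewrite !linE.
  apply: (integral_same_gram (f := fun u : 'cV[R]_1 => (u 0 0)%:E)).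
    by rewrite [in LHS]mulNmx [(- _)^T]raddfN/= mulNmx mulmxN opprK.
  by apply/measurable_EFinP; exact: measurable_entry.
(* Finiteness makes E = - E an equation between reals, so E = 0. *)
rewrite EN -(fineK fE) -EFinN => -[/eqP]; rewrite eq_sym -addr_eq0 -mulr2n.
by rewrite mulrn_eq0/= => /eqP ->.
Qed.

(** Polarization: the variance of the form of [l + k] is expanded in two ways, the cross terms
    agreeing since [S] is symmetric. *)
Lemma covariance_centered_linear l k :
  covariance P (centered_linear l) (centered_linear k) =
  ((l *m S *m k^T) 0 0)%:E.
Proof.
have Pfin : P setT \is a fin_num := fin_num_measure P _ measurableT.
have L2 := Lfun2_centered_linear.
have L1 j : centered_linear j \in Lfun P 1 := Lfun_subset12 Pfin (L2 j).
have varE j : ('V_P[centered_linear j] = ((j *m S *m j^T) 0 0)%:E)%E.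
  rewrite varianceE// expectation_centered_linear expectation_centered_linear_sqr.
  by rewrite -EFin_expe expr0n sube0.
have addE : centered_linear l \+ centered_linear k = centered_linear (l + k).
  by apply/funext => w; rewrite /centered_linear mulmxDl mxE.
have symE : (k *m S *m l^T) 0 0 = (l *m S *m k^T) 0 0.
  transitivity ((k *m S *m l^T)^T 0 0); first by rewrite [RHS]mxE.
  by rewrite !trmx_mul trmxK gX.1.1 mulmxA.
have add00 (M N : 'M[R]_1) : (M + N) 0 0 = M 0 0 + N 0 0 by rewrite mxE.
have cfin := covariance_fin_num (L1 l) (L1 k) (Lfun2_mul_Lfun1 (L2 l) (L2 k)).
have := varianceD (L2 l) (L2 k); rewrite addE !varE -(fineK cfin).
rewrite -EFinM -!EFinD => -[]; rewrite raddfD/= !mulmxDl !mulmxDr !add00 symE.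
by move=> h; congr _%:E; lra.
Qed.

End gaussian_laws.

(** * Mean and covariance of the layer *)

Lemma row_mul_entry (R : pzRingType) m n (M : 'M[R]_(m, n)) (x : 'cV[R]_n) i :
  (row i M *m x) 0 0 = (M *m x) i 0.
Proof. by rewrite -row_mul mxE. Qed.

Lemma row_mul_form (R : pzRingType) m n (M N : 'M[R]_(m, n)) (S : 'M[R]_n) i j :
  (row i M *m S *m (row j N)^T) 0 0 = (M *m S *m N^T) i j.
Proof.
by rewrite tr_row -row_mul [LHS]mxE [RHS]mxE; apply: eq_bigr => k _; rewrite !mxE.
Qed.

Lemma Lfun2D d (T : measurableType d) (R : realType) (P : probability T R)
    (f g : T -> R) :
  f \in Lfun P 2%:E -> g \in Lfun P 2%:E -> f \+ g \in Lfun P 2%:E.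
Proof. by move=> f2 g2; rewrite rpredD ?lee1n. Qed.

Lemma covarianceD_cst d (T : measurableType d) (R : realType)
    (P : probability T R) (f g : T -> R) (a b : R) :
  f \in Lfun P 2%:E -> g \in Lfun P 2%:E ->
  covariance P (f \+ cst a) (g \+ cst b) = covariance P f g.
Proof.
move=> f2 g2; have c2 (c : R) : cst c \in Lfun P 2%:E := Lfun_cst P c 2.
rewrite covarianceDl//; last exact: Lfun2D.
by rewrite covariance_cst_l adde0 covarianceDr// covariance_cst_r adde0.
Qed.

Theorem lemma2p4 (R : realType) (disp : measure_display)
    (T : measurableType disp) (P : probability T R) (m n : nat)
    (sigma : R -> R) (A C : 'M[R]_(m, n)) (b d : 'cV[R]_m)
    (mu : 'cV[R]_n) (Sigma : 'M[R]_n) (X : {RV P >-> 'cV[R]_n}) :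
  measurable_fun [set: R] sigma ->
  is_gaussian P X mu Sigma ->
  (forall i, ('E_P[(fun w => sigma ((A *m X w + b) i 0) ^+ 2)%R] < +oo)%E) ->
  let eta := A *m mu + b in
  let nu := A *m Sigma *m A^T in
  let tau := C *m Sigma *m C^T in
  let kappa := A *m Sigma *m C^T in
  let Y w := g_layer sigma A b C d (X w) in
  (forall i, mean_vec P Y i 0 =
     (Msig sigma (eta i 0) (nu i i) + (C *m mu) i 0 + d i 0)%:E) /\
  (forall i j, cov_mx P Y i j =
     (Ksig sigma (eta i 0) (eta j 0) (nu i i) (nu j j) (nu i j)
      + Lsig sigma (eta i 0) (nu i i) (tau j j) (kappa i j)
      + Lsig sigma (eta j 0) (nu j j) (tau i i) (kappa j i)
      + tau i j)%:E).
Proof.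
move=> msigma gX sigma2 eta nu tau kappa Y.
have Pfin : P setT \is a fin_num := fin_num_measure P _ measurableT.
(* Each output splits into a nonlinear part [s i], a centred linear part [z i] and a constant [c i],
   to which the covariance is blind. *)
pose s i w := sigma ((A *m X w + b) i 0).
pose z i := centered_linear X mu (row i C).
pose c i := (C *m mu) i 0 + d i 0.
have sE i : s i = fun w => sigma ((row i A *m X w) 0 0 + b i 0).
  by apply/funext => w; rewrite row_mul_entry /s mxE.
have zE i : z i = fun w => (row i C *m X w) 0 0 - (C *m mu) i 0.
  apply/funext => w; rewrite /z /centered_linear mulmxBr -(row_mul_entry C mu).
  by rewrite mxE [X in _ + X]mxE.
have YE i : (fun w => Y w i 0) = (s i \+ z i) \+ cst (c i).
  apply/funext => w; rewrite /= zE row_mul_entry /Y /g_layer /s /c.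
  by rewrite mxE [(_ + C *m _) i 0]mxE [map_mx _ _ _ _]mxE /cst; ring.
have etaE i : (row i A *m mu) 0 0 + b i 0 = eta i 0.
  by rewrite row_mul_entry [RHS]mxE.
have s2 i : s i \in Lfun P 2%:E.
  apply: Lfun2_sqr_lty; last by have := sigma2 i; rewrite unlock.
  rewrite sE; apply: (measurableT_comp msigma); apply: measurable_funD => //.
  apply: (measurableT_comp (measurable_entry 0 0)).
  exact: (measurableT_comp (measurable_mulmx _)).
have z2 i : z i \in Lfun P 2%:E := Lfun2_centered_linear gX _.
have s1 i : s i \in Lfun P 1 := Lfun_subset12 Pfin (s2 i).
have z1 i : z i \in Lfun P 1 := Lfun_subset12 Pfin (z2 i).
have sz2 i : s i \+ z i \in Lfun P 2%:E by exact: Lfun2D.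
have cov_fin f g : f \in Lfun P 2%:E -> g \in Lfun P 2%:E ->
    covariance P f g = (fine (covariance P f g))%:E.
  move=> f2 g2; rewrite fineK// covariance_fin_num//.
  - exact: Lfun_subset12.
  - exact: Lfun_subset12.
  - exact: Lfun2_mul_Lfun1.
(* The centred form [z j] has mean 0, the value fixed in [Lsig]; the second activation is the
   identity. *)
have Ls i j : covariance P (s i) (z j) =
    (Lsig sigma (eta i 0) (nu i i) (tau j j) (kappa i j))%:E.
  have mid := @measurable_id _ R setT.
  rewrite cov_fin// sE zE (covariance_linear_gaussian gX _ _ _ _ msigma mid).
  by rewrite etaE !row_mul_form row_mul_entry subrr.
split=> [i|i j].
- rewrite mxE YE expectationD//; last first.
  + exact: Lfun_cst.
  + exact: (Lfun_subset12 Pfin (sz2 i)).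
  rewrite expectationD// [X in (_ + X + _)%E](expectation_centered_linear gX).
  rewrite adde0 expectation_cst -(fineK (expectation_fin_num (s1 i))) -EFinD /c addrA.
  congr (_ + _ + _)%:E.
  by rewrite sE (expectation_linear_gaussian gX)// etaE row_mul_form.
(* Bilinearity leaves four covariances; symmetry turns that of [z i] and [s j] into an L term with
   the indices exchanged. *)
- rewrite mxE !YE covarianceD_cst// covarianceDl// !covarianceDr//.
  rewrite [covariance P (z i) (s j)]covarianceC !Ls.
  rewrite [covariance P (z i) (z j)](covariance_centered_linear gX) row_mul_form.
  rewrite cov_fin// !sE (covariance_linear_gaussian gX)// !etaE !row_mul_form.
  by rewrite -!EFinD !addrA.
Qed.
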